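(* The maximum SOS rank of $4\times 3$ simple biquadratic forms is $7$. That is, every $4\times 3$ simple biquadratic form $P$ satisfies $\operatorname{sos}(P)\le 7$, and there exists a $4\times 3$ simple biquadratic form $P$ with $\operatorname{sos}(P)=7$.
   Context: An $m\times n$ biquadratic form in variables $\mathbf{x}=(x_1,\dots,x_m)$ and $\mathbf{y}=(y_1,\dots,y_n)$ is a polynomial $P(\mathbf{x},\mathbf{y})=\sum_{i,k=1}^{m}\sum_{j,l=1}^{n}a_{ijkl}\,x_ix_ky_jy_l$ with real coefficients. It is sum-of-squares (SOS) if it can be written as a finite sum of squares of real bilinear forms $\ell(\mathbf{x},\mathbf{y})=\sum_{i=1}^{m}\sum_{j=1}^{n}c_{ij}x_iy_j$. For an SOS form $P$, its SOS rank $\operatorname{sos}(P)$ is the smallest number of squares of bilinear forms in such a representation. A biquadratic form is called simple if it contains only distinct terms of the type $x_i^2y_j^2$, each with coefficient $1$; i.e. $P=\sum_{(i,j)\in E}x_i^2y_j^2$ for some set $E\subseteq\{1,\dots,m\}\times\{1,\dots,n\}$. *)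

(* Defs.v *)
From mathcomp Require Import all_boot all_order all_algebra.
From mathcomp Require Import reals mpoly.

Set Implicit Arguments.
Unset Strict Implicit.
Unset Printing Implicit Defensive.

Import GRing.Theory.
Local Open Scope ring_scope.

(* The variables of {mpoly R[m + n]} are x_1, ..., x_m followed by
   y_1, ..., y_n; indices are 0-based. *)
Definition xvar (R : realType) (m n : nat) (i : 'I_m) : {mpoly R[m + n]} :=
  'X_(lshift n i).
Definition yvar (R : realType) (m n : nat) (j : 'I_n) : {mpoly R[m + n]} :=
  'X_(rshift m j).
Arguments xvar {R m} n i.
Arguments yvar {R} m {n} j.

Definition is_biquadratic (R : realType) (m n : nat)
    (P : {mpoly R[m + n]}) : Prop :=
  exists a : 'I_m -> 'I_n -> 'I_m -> 'I_n -> R,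
    P = \sum_(i < m) \sum_(k < m) \sum_(j < n) \sum_(l < n)
          a i j k l *: (xvar n i * xvar n k * yvar m j * yvar m l).
Arguments is_biquadratic {R} m n P.

Definition bilinear_form (R : realType) (m n : nat) (c : 'M[R]_(m, n)) :
    {mpoly R[m + n]} :=
  \sum_(i < m) \sum_(j < n) c i j *: (xvar n i * yvar m j).

Definition sum_of_r_squares (R : realType) (m n : nat)
    (P : {mpoly R[m + n]}) (r : nat) : Prop :=
  exists c : 'I_r -> 'M[R]_(m, n), P = \sum_(t < r) bilinear_form (c t) ^+ 2.
Arguments sum_of_r_squares {R} m n P r.

(* [sos_rank m n P r] reads sos(P) = r. It is a relation because sos(P) is only
   defined when P is SOS. *)
Definition sos_rank (R : realType) (m n : nat)
    (P : {mpoly R[m + n]}) (r : nat) : Prop :=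
  sum_of_r_squares m n P r /\ (forall s : nat, sum_of_r_squares m n P s -> (r <= s)%N).
Arguments sos_rank {R} m n P r.

Definition is_simple (R : realType) (m n : nat)
    (P : {mpoly R[m + n]}) : Prop :=
  is_biquadratic m n P /\
  exists E : {set 'I_m * 'I_n},
    P = \sum_(p in E) xvar n p.1 ^+ 2 * yvar m p.2 ^+ 2.
Arguments is_simple {R} m n P.

(* Main.v *)
Require Import Defs.
From mathcomp Require Import all_boot all_order all_algebra.
From mathcomp Require Import boolp reals mpoly.
From mathcomp Require Import zify ring lra.

Set Implicit Arguments.
Unset Strict Implicit.
Unset Printing Implicit Defensive.

Import GRing.Theory Num.Theory.
Local Open Scope ring_scope.

(** A simple biquadratic form P is a bipartite graph E between the rows x_i and
    the columns y_j; write P_E for its form.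

    For the upper bound, P_E is a sum of #|E| squares (x_i y_j)^2, and two
    blocks can be written more cheaply. A 2 x 2 block takes 2 squares rather
    than 4, by the two-square identity, and a 3 x 3 block takes 4 rather than 9,
    by Lagrange's identity |u|^2 |v|^2 = (u.v)^2 + |u x v|^2. So a graph
    with more than 7 edges must offer a total saving of at least #|E| - 7:
    - with 8 or 9 edges, one 2 x 2 block saves 2, and such a block exists
      because a 4-cycle-free subgraph of K_{4,3} has at most 4 + 3 edges;
    - with 10 or more edges, either the missing edges lie in one row, and the
      other rows form a 3 x 3 block, saving 5; or exactly two edges are missing,
      from different rows, and two row-disjoint 2 x 2 blocks avoid them, saving 4.

    For the lower bound, write P_E as the sum of (x^T c_t y)^2 over t < s, and
    let v_ij in R^s be the vector of the entries (c_t)_ij. Comparing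
    coefficients, |v_ij|^2 is 1 on E and 0 off E, vectors in the same row or the
    same column are orthogonal, and v_ij.v_kl + v_il.v_kj = 0 otherwise. If E
    has no 4-cycle then, for two edges ij and kl sharing neither row nor
    column, one of il, kj is not an edge, which kills the second product. Hence
    the #|E| vectors of the edges are orthonormal in R^s and #|E| <= s: the SOS
    rank is #|E| ([c4_free_sos_rank]). A 6-cycle through all three columns with
    a pendant edge on the fourth row is 4-cycle-free with 7 edges. *)

(** * Forms of bipartite graphs and cheap blocks *)

Definition edge_form (R : realType) (m n : nat) (E : {set 'I_m * 'I_n}) :
    {mpoly R[m + n]} :=
  \sum_(p in E) xvar n p.1 ^+ 2 * yvar m p.2 ^+ 2.
Arguments edge_form R {m n} E.

Definition c4_free (m n : nat) (E : {set 'I_m * 'I_n}) : Prop :=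
  forall i k j l, i != k -> j != l ->
    ~~ [&& (i, j) \in E, (i, l) \in E, (k, j) \in E & (k, l) \in E].

Section SumsOfSquares.
Variables (R : realType) (m n : nat).
Implicit Types (P Q : {mpoly R[m + n]}) (E F : {set 'I_m * 'I_n}).
Implicit Types (A : {set 'I_m}) (B : {set 'I_n}).

Lemma edge_form_is_simple E : is_simple m n (edge_form R E).
Proof.
split; last by exists E.
exists (fun i j k l => [&& i == k, j == l & (i, j) \in E]%:R).
rewrite /edge_form big_mkcond /=.
under [RHS]eq_bigr => i _.
  rewrite (bigD1 i) //= [X in _ + X]big1 ?addr0; last first.
    move=> k /negbTE ki; rewrite big1 // => j _; rewrite big1 // => l _.
    by rewrite eq_sym ki scale0r.
  under eq_bigr => j _.
    rewrite (bigD1 j) //= big1 ?addr0; last first.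
      by move=> l /negbTE lj; rewrite eq_sym lj andbF scale0r.
    rewrite !eqxx /=; over.
  over.
rewrite pair_big /=; apply: eq_bigr => -[i j] _ /=.
by case: ifP => _; rewrite ?scale0r // scale1r !expr2 !mulrA.
Qed.

Lemma bilinear_formD (c d : 'M[R]_(m, n)) :
  bilinear_form (c + d) = bilinear_form c + bilinear_form d.
Proof.
rewrite /bilinear_form -big_split; apply: eq_bigr => i _ /=.
by rewrite -big_split; apply: eq_bigr => j _ /=; rewrite mxE scalerDl.
Qed.

Lemma bilinear_formN (c : 'M[R]_(m, n)) :
  bilinear_form (- c) = - bilinear_form c.
Proof.
rewrite /bilinear_form -sumrN; apply: eq_bigr => i _ /=.
by rewrite -sumrN; apply: eq_bigr => j _ /=; rewrite mxE scaleNr.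
Qed.

Lemma bilinear_form_delta (i : 'I_m) (j : 'I_n) :
  bilinear_form (delta_mx i j : 'M[R]_(m, n)) = xvar n i * yvar m j.
Proof.
rewrite /bilinear_form (bigD1 i) //= [X in _ + X]big1 => [|k /negbTE ki].
  rewrite (bigD1 j) //= [X in _ + X + _]big1 => [|l /negbTE lj].
    by rewrite mxE !eqxx scale1r !addr0.
  by rewrite mxE lj andbF scale0r.
by rewrite big1 // => l _; rewrite mxE ki scale0r.
Qed.

Lemma sum_of_squares_seq (s : seq 'M[R]_(m, n)) :
  sum_of_r_squares m n (\sum_(c <- s) bilinear_form c ^+ 2) (size s).
Proof. by exists (fun t => s`_t); rewrite (big_nth 0) big_mkord. Qed.

Lemma sum_of_squaresD P Q r s :
    sum_of_r_squares m n P r -> sum_of_r_squares m n Q s ->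
  sum_of_r_squares m n (P + Q) (r + s).
Proof.
move=> [c ->] [d ->].
exists (fun t => match split t with inl a => c a | inr b => d b end).
rewrite big_split_ord; congr (_ + _); apply: eq_bigr => t _.
  by rewrite (unsplitK (inl t)).
by rewrite (unsplitK (inr t)).
Qed.

Lemma edge_form_squares_card E : sum_of_r_squares m n (edge_form R E) #|E|.
Proof.
pose s := [seq delta_mx p.1 p.2 : 'M[R]_(m, n) | p <- enum E].
have -> : edge_form R E = \sum_(d <- s) bilinear_form d ^+ 2.
  rewrite big_map big_enum; apply: eq_bigr => p _.
  by rewrite bilinear_form_delta exprMn.
by have := sum_of_squares_seq s; rewrite size_map -cardE.
Qed.

(** A cheap representation of a subgraph gives one for the whole graph, each
    remaining edge costing one square: savings carry over to supergraphs. *)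
Lemma edge_form_squares_sub E F r :
    F \subset E -> sum_of_r_squares m n (edge_form R F) r ->
  sum_of_r_squares m n (edge_form R E) (r + (#|E| - #|F|)).
Proof.
move=> sFE sosF; rewrite -(cardsDS sFE).
rewrite /edge_form (big_setID F) /= (setIidPr sFE).
exact: sum_of_squaresD (edge_form_squares_card _).
Qed.

Lemma edge_form_squaresU E F r s :
    [disjoint E & F] ->
    sum_of_r_squares m n (edge_form R E) r ->
    sum_of_r_squares m n (edge_form R F) s ->
  sum_of_r_squares m n (edge_form R (E :|: F)) (r + s).
Proof.
move=> dEF sosE sosF; rewrite /edge_form; under eq_bigl => p do rewrite in_setU.
by rewrite bigU //; apply: sum_of_squaresD.
Qed.

Lemma edge_form_setX A B :
  edge_form R (setX A B) =
  (\sum_(i in A) xvar n i ^+ 2) * (\sum_(j in B) yvar m j ^+ 2).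
Proof.
rewrite big_distrlr pair_big /=; apply: eq_bigl => p.
by rewrite inE.
Qed.

(** The two-square identity
    (a^2 + a'^2) (b^2 + b'^2) = (ab + a'b')^2 + (ab' - a'b)^2. *)
Lemma block22_squares A B :
    #|A| = 2%N -> #|B| = 2%N -> sum_of_r_squares m n (edge_form R (setX A B)) 2.
Proof.
move=> /eqP/cards2P[a [a' [aa' ->]]] /eqP/cards2P[b [b' [bb' ->]]].
pose e i j : 'M[R]_(m, n) := delta_mx i j.
have := sum_of_squares_seq [:: e a b + e a' b'; e a b' - e a' b].
suff -> : edge_form R (setX [set a; a'] [set b; b']) =
    \sum_(c <- [:: e a b + e a' b'; e a b' - e a' b]) bilinear_form c ^+ 2 by [].
rewrite edge_form_setX !big_setU1 ?inE //= !big_set1 !big_cons big_nil.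
rewrite !(bilinear_formD, bilinear_formN, bilinear_form_delta).
ring.
Qed.

Lemma cards3E (T : finType) (S : {set T}) :
    #|S| = 3%N ->
  exists x y z, [/\ S = [set x; y; z], x != y, x != z & y != z].
Proof.
move=> S3; have /card_gt0P[x xS] : (0 < #|S|)%N by rewrite S3.
have := cardsD1 x S; rewrite S3 xS => -[] /esym/eqP/cards2P[y [z [yz Sx]]].
have : y \in S :\ x by rewrite Sx set21.
have : z \in S :\ x by rewrite Sx set22.
rewrite !inE => /andP[zx _] /andP[yx _]; exists x, y, z.
by rewrite !(eq_sym x) -setUA -Sx setD1K.
Qed.

(** Lagrange's identity: one square for the scalar product and three for the
    coordinates of the cross product. *)
Lemma block33_squares A B :
    #|A| = 3%N -> #|B| = 3%N -> sum_of_r_squares m n (edge_form R (setX A B)) 4.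
Proof.
move=> /cards3E[a [a' [a'' [-> aa' aa'' aa3]]]].
move=> /cards3E[b [b' [b'' [-> bb' bb'' bb3]]]].
pose e i j : 'M[R]_(m, n) := delta_mx i j.
pose s := [:: e a b + e a' b' + e a'' b'';
  e a b' - e a' b; e a b'' - e a'' b; e a' b'' - e a'' b'].
have := sum_of_squares_seq s.
suff -> : edge_form R (setX [set a; a'; a''] [set b; b'; b'']) =
    \sum_(c <- s) bilinear_form c ^+ 2 by [].
rewrite edge_form_setX -!setUA !big_setU1 ?inE ?negb_or ?aa' ?bb' //=.
rewrite !big_set1 !big_cons big_nil.
rewrite !(bilinear_formD, bilinear_formN, bilinear_form_delta).
ring.
Qed.

End SumsOfSquares.

(** * The lower bound for graphs without 4-cycles *)

Section LowerBound.
Variables (R : realType) (m n : nat) (E : {set 'I_m * 'I_n}) (s : nat).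
Variable c : 'I_s -> 'M[R]_(m, n).
Hypothesis Ec : edge_form R E = \sum_(t < s) bilinear_form (c t) ^+ 2.

Let form_at t (x : 'rV[R]_m) (y : 'rV[R]_n) : R := (x *m c t *m y^T) 0 0.

Lemma form_atDl t x x' y : form_at t (x + x') y = form_at t x y + form_at t x' y.
Proof. by rewrite /form_at !mulmxDl mxE. Qed.

Lemma form_atDr t x y y' : form_at t x (y + y') = form_at t x y + form_at t x y'.
Proof. by rewrite /form_at linearD mulmxDr mxE. Qed.

Lemma form_at_delta t i j : form_at t (delta_mx 0 i) (delta_mx 0 j) = c t i j.
Proof. by rewrite /form_at -rowE trmx_delta -colE !mxE. Qed.

(** Evaluating at real points replaces the comparison of polynomial
    coefficients. *)
Lemma sum_form_at_sqr x y :
  \sum_(t < s) form_at t x y ^+ 2 = \sum_(p in E) x 0 p.1 ^+ 2 * y 0 p.2 ^+ 2.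
Proof.
pose v k := row_mx x y 0 k.
have vx i : (xvar n i).@[v] = x 0 i by rewrite mevalXU /v row_mxEl.
have vy j : (yvar m j).@[v] = y 0 j by rewrite mevalXU /v row_mxEr.
have := congr1 (meval v) Ec; rewrite /edge_form !raddf_sum /= => Ev.
under [RHS]eq_bigr => p _ do rewrite -vx -vy -!rmorphXn -rmorphM /=.
rewrite Ev; apply: eq_bigr => t _; rewrite rmorphXn /=; congr (_ ^+ 2).
rewrite /bilinear_form /form_at raddf_sum /= mxE.
under [LHS]eq_bigr => j _ do rewrite mxE big_distrl.
rewrite exchange_big; apply: eq_bigr => i _ /=.
rewrite raddf_sum /=; apply: eq_bigr => j _.
by rewrite mevalZ rmorphM /= vx vy mxE; ring.
Qed.

Let delta_sqr k (i i' a : 'I_k) : i != i' ->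
  ((delta_mx 0 i + delta_mx 0 i' : 'rV[R]_k) 0 a) ^+ 2 =
  (delta_mx 0 i : 'rV[R]_k) 0 a ^+ 2 + (delta_mx 0 i' : 'rV[R]_k) 0 a ^+ 2.
Proof.
move=> ii'; rewrite !mxE /=; case: (eqVneq a i) => [->|_].
  by rewrite (negbTE ii') /=; ring.
by rewrite /=; ring.
Qed.

(** The form of a graph contains no product x_i x_k, so its value at
    e_i + e_k is the sum of its values at e_i and e_k; the cross terms of the
    squares must cancel. Keeping y arbitrary allows a second polarization,
    in y, which yields the relation v_ij.v_kl + v_il.v_kj = 0. *)
Lemma sum_form_at_row_orthogonal i k y : i != k ->
  \sum_(t < s) form_at t (delta_mx 0 i) y * form_at t (delta_mx 0 k) y = 0.
Proof.
move=> ik; have := sum_form_at_sqr (delta_mx 0 i + delta_mx 0 k) y.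
under eq_bigr => t _ do rewrite form_atDl sqrrD.
under [RHS]eq_bigr => p _ do rewrite delta_sqr // mulrDl.
rewrite !big_split /= !sum_form_at_sqr; lra.
Qed.

Lemma sum_form_at_col_orthogonal x j l : j != l ->
  \sum_(t < s) form_at t x (delta_mx 0 j) * form_at t x (delta_mx 0 l) = 0.
Proof.
move=> jl; have := sum_form_at_sqr x (delta_mx 0 j + delta_mx 0 l).
under eq_bigr => t _ do rewrite form_atDr sqrrD.
under [RHS]eq_bigr => p _ do rewrite delta_sqr // mulrDr.
rewrite !big_split /= !sum_form_at_sqr; lra.
Qed.

Lemma sum_entry_sqr i j : \sum_(t < s) c t i j ^+ 2 = ((i, j) \in E)%:R.
Proof.
under eq_bigr => t _ do rewrite -form_at_delta.
rewrite sum_form_at_sqr big_mkcond (bigD1 (i, j)) //= big1 => [|[k l] /= ne].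
  by rewrite !mxE !eqxx; case: ifP => _; rewrite ?expr1n ?mulr1 addr0.
case: ifP => // _; rewrite !mxE /=; move: ne; rewrite xpair_eqE.
by case: eqP => //= _; [case: eqP => //= _|]; rewrite expr0n /= ?mul0r ?mulr0.
Qed.

Lemma entry_notin t i j : (i, j) \notin E -> c t i j = 0.
Proof.
move=> /negbTE nE; have := sum_entry_sqr i j; rewrite nE.
move=> /psumr_eq0P => /(_ (fun t _ => sqr_ge0 (c t i j)) t isT) /eqP.
by rewrite sqrf_eq0 => /eqP.
Qed.

Lemma entries_orthogonal : c4_free E -> {in E &, forall p q, p != q ->
  \sum_(t < s) c t p.1 p.2 * c t q.1 q.2 = 0}.
Proof.
move=> c4E [i j] [k l] ijE klE; rewrite xpair_eqE /=.
have row_orth i' k' j' : i' != k' -> \sum_(t < s) c t i' j' * c t k' j' = 0.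
  move=> ik'; rewrite -[RHS](sum_form_at_row_orthogonal (delta_mx 0 j') ik').
  by apply: eq_bigr => t _; rewrite !form_at_delta.
case: (eqVneq i k) => [-> /= jl | ik].
  rewrite -[RHS](sum_form_at_col_orthogonal (delta_mx 0 k) jl).
  by apply: eq_bigr => t _; rewrite !form_at_delta.
case: (eqVneq j l) => [-> _ | jl _]; first exact: row_orth.
(* The products within a row or a column vanish, which leaves
   v_ij.v_kl + v_il.v_kj = 0. *)
have := sum_form_at_row_orthogonal (delta_mx 0 j + delta_mx 0 l) ik.
under [X in X = _ -> _]eq_bigr => t _
  do rewrite !form_atDr !form_at_delta mulrDl !mulrDr.
rewrite !big_split /= !row_orth // add0r addr0.
have := c4E i k j l ik jl; rewrite ijE klE andbT /= negb_and.
move=> no4; rewrite [X in _ + X]big1 ?addr0 // => t _.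
by case/orP: no4 => /entry_notin ->; rewrite ?mul0r ?mulr0.
Qed.

Lemma c4_free_card_le : c4_free E -> (#|E| <= s)%N.
Proof.
move=> c4E; pose ev (a : 'I_#|E|) := enum_val a.
pose V := \matrix_(a < #|E|, t < s) c t (ev a).1 (ev a).2.
(* Orthonormality of the rows of V says V V^T = 1, so V has no more rows than
   columns. *)
apply: (@mulmx1_min _ _ _ V V^T); apply/matrixP => a b; rewrite !mxE.
under eq_bigr => t _ do rewrite !mxE.
have evE d : ev d \in E by exact: enum_valP.
case: (eqVneq a b) => [<- | ab]; last first.
  by rewrite entries_orthogonal // (inj_eq enum_val_inj).
under eq_bigr => t _ do rewrite -expr2.
by rewrite sum_entry_sqr -surjective_pairing evE.
Qed.

End LowerBound.

(** Without 4-cycles no square can be saved. *)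
Theorem c4_free_sos_rank (R : realType) (m n : nat) (E : {set 'I_m * 'I_n}) :
  c4_free E -> sos_rank m n (edge_form R E) #|E|.
Proof.
move=> c4E; split; first exact: edge_form_squares_card.
by move=> s [c Ec]; apply: c4_free_card_le Ec c4E.
Qed.

(** * The upper bound for 4 x 3 graphs *)

Lemma card_sum_rows (m n : nat) (E : {set 'I_m * 'I_n}) :
  #|E| = (\sum_i \sum_j ((i, j) \in E))%N.
Proof.
by rewrite pair_big /= -sum1_card big_mkcond; apply: eq_bigr => -[i j].
Qed.

(** A pair of columns is named by the third column c, which it omits. A row of
    degree d contains at least d - 1 of the three pairs (0, 1, 3 pairs for
    d = 1, 2, 3), so the m rows contain at least #|E| - m > 3 pairs in all, and
    some pair is contained in two rows. *)
Lemma block22_of_card_gt (m : nat) (E : {set 'I_m * 'I_3}) : (m + 3 < #|E|)%N ->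
  exists (A : {set 'I_m}) (B : {set 'I_3}),
    [/\ #|A| = 2%N, #|B| = 2%N & setX A B \subset E].
Proof.
move=> cardE.
pose covers i c := [forall j, (j != c) ==> ((i, j) \in E)].
have row_le i : (\sum_j ((i, j) \in E) <= (\sum_c covers i c).+1)%N.
  have cov c : covers i c = [&& (ord0 != c) ==> ((i, ord0) \in E),
      (lift ord0 ord0 != c) ==> ((i, lift ord0 ord0) \in E) &
      (ord_max != c) ==> ((i, ord_max) \in E)].
    apply/forallP/and3P => [H | [H0 H1 H2] j]; first by split; apply: H.
    case: j => [[|[|[|//]]] lt_j].
    - by rewrite (_ : Ordinal lt_j = ord0) //; apply: val_inj.
    - by rewrite (_ : Ordinal lt_j = lift ord0 ord0) //; apply: val_inj.
    - by rewrite (_ : Ordinal lt_j = ord_max) //; apply: val_inj.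
  rewrite !big_ord_recl !big_ord0 !cov /=.
  rewrite (_ : lift ord0 (lift ord0 ord0) = ord_max :> 'I_3); last exact: val_inj.
  by do 3 case: ((i, _) \in E).
have /existsP[c c_gt1] : [exists c, (1 < #|[set i | covers i c]|)%N].
  apply: contraLR cardE; rewrite negb_exists -leqNgt => /forallP no_c.
  rewrite card_sum_rows.
  apply: (@leq_trans (\sum_(i < m) (\sum_c covers i c).+1)%N).
    by apply: leq_sum => i _; apply: row_le.
  under eq_bigr => i _ do rewrite -add1n.
  rewrite big_split /= sum_nat_const card_ord muln1 leq_add2l exchange_big /=.
  apply: (@leq_trans (\sum_(c < 3) 1)%N); last by rewrite sum_nat_const card_ord.
  apply: leq_sum => c _; have := no_c c; rewrite -leqNgt -sum1_card.
  by rewrite big_mkcond /=; under eq_bigr => i _ do rewrite inE.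
have /card_gt1P[i [k [ci ck ik]]] := c_gt1.
exists [set i; k], [set~ c]; split.
- by rewrite cards2 ik.
- by rewrite cardsC1 card_ord.
apply/subsetP => -[a b] /setXP[]; rewrite !inE => ab bc.
have : covers a c by case/orP: ab => /eqP ->; [move: ci|move: ck]; rewrite inE.
by move=> /forallP/(_ b)/implyP; apply.
Qed.

(** Every graph with more than 7 edges contains blocks that save the excess. *)
Lemma edge_form43_squares (R : realType) (E : {set 'I_4 * 'I_3}) :
  exists2 r, sum_of_r_squares 4 3 (edge_form R E) r & (r <= 7)%N.
Proof.
have := cardsC E; rewrite card_prod !card_ord => cardC.
have [E7|E7] := leqP #|E| 7.
  by exists #|E|; first exact: edge_form_squares_card.
have [E9|E9] := leqP #|E| 9.
  have [A [B [A2 B2 sAB]]] := block22_of_card_gt E7.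
  exists (2 + (#|E| - #|setX A B|))%N; last by rewrite cardsX A2 B2; lia.
  by apply: edge_form_squares_sub => //; apply: block22_squares.
(* From here on at most two edges are missing. *)
have [/existsP[r /subsetP Cr]|] :=
    boolP [exists r, ~: E \subset setX [set r] [set: 'I_3]].
  have sub : setX [set~ r] [set: 'I_3] \subset E.
    apply/subsetP => p; rewrite !inE andbT; apply: contraNT => pE.
    by have := Cr p; rewrite !inE andbT => ->.
  exists (4 + (#|E| - #|setX [set~ r] [set: 'I_3]|))%N; last first.
    rewrite cardsX cardsC1 cardsT !card_ord; lia.
  apply: edge_form_squares_sub => //; apply: block33_squares.
    by rewrite cardsC1 card_ord.
  by rewrite cardsT card_ord.
rewrite negb_exists => /forallP Cr.
(* The missing edges are exactly p and q, in different rows. Each of these rows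
   is paired with one of the two complete rows a and b, on the two columns
   where it is complete. *)
have /subsetPn[p pC _] := Cr ord0.
have /subsetPn[q qC] := Cr p.1; rewrite !inE andbT => qp.
have Epq : ~: E = [set p; q].
  apply/esym/eqP; rewrite eqEcard subUset !sub1set pC qC cards2.
  have -> : p != q by apply: contraNneq qp => ->.
  lia.
have /eqP/cards2P[a [b [ab Cpq]]] : #|~: [set p.1; q.1]| = 2%N.
  have := cardsC [set p.1; q.1]; rewrite card_ord cards2 eq_sym qp; lia.
have : a \in ~: [set p.1; q.1] by rewrite Cpq set21.
have : b \in ~: [set p.1; q.1] by rewrite Cpq set22.
rewrite !inE !negb_or => /andP[bp bq] /andP[ap aq].
pose F := setX [set p.1; a] [set~ p.2]; pose G := setX [set q.1; b] [set~ q.2].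
have cardX i k (j : 'I_3) : i != k ->
    #|[set i; k] : {set 'I_4}| = 2%N /\ #|[set~ j]| = 2%N.
  by move=> ik; rewrite cards2 ik cardsC1 card_ord.
have [F1 F2] := cardX p.1 a p.2 (contraNneq (fun e => introT eqP (esym e)) ap).
have [G1 G2] := cardX q.1 b q.2 (contraNneq (fun e => introT eqP (esym e)) bq).
have dFG : [disjoint F & G].
  rewrite -setI_eq0; apply/eqP/setP => -[u v]; rewrite !inE /=.
  apply/negP => /andP[/andP[/orP[]/eqP-> _] /andP[/orP[]/eqP e _]].
  - by rewrite e eqxx in qp.
  - by rewrite e eqxx in bp.
  - by rewrite e eqxx in aq.
  - by rewrite e eqxx in ab.
have sFG : F :|: G \subset E.
  apply/subsetP => u uFG; apply: contraT => uE.
  have : u \in ~: E by rewrite inE.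
  rewrite Epq !inE => /orP[]/eqP e; move: uFG; rewrite e !inE !eqxx ?andbF ?orbF ?orFb.
    by rewrite eq_sym (negbTE qp) eq_sym (negbTE bp).
  by rewrite (negbTE qp) eq_sym (negbTE aq).
exists (2 + 2 + (#|E| - #|F :|: G|))%N.
  apply: edge_form_squares_sub => //; apply: edge_form_squaresU => //.
    exact: block22_squares.
  exact: block22_squares.
have C0 : (0 < #|~: E|)%N by apply/card_gt0P; exists p.
have -> : #|F :|: G| = 8%N.
  by rewrite cardsU (disjoint_setI0 dFG) cards0 !cardsX F1 F2 G1 G2.
lia.
Qed.

(** * A 4-cycle-free graph with 7 edges *)

Definition hexagon_pendant : {set 'I_4 * 'I_3} :=
  [set p | if p.1 == ord_max then p.2 == ord0 else p.1 != p.2 :> nat].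

Lemma card_hexagon_pendant : #|hexagon_pendant| = 7%N.
Proof.
by rewrite card_sum_rows !big_ord_recl !big_ord0 !inE.
Qed.

(** The three hexagon rows contain the three different pairs of columns, one
    each, and the pendant row has a single column: no two rows share a pair. *)
Lemma hexagon_pendant_c4_free : c4_free hexagon_pendant.
Proof.
move=> i k j l; rewrite !inE -!val_eqE /=.
case: i => [[|[|[|[|i]]]] i4] //=; case: k => [[|[|[|[|k]]]] k4] //=;
case: j => [[|[|[|j]]] j3] //=; by case: l => [[|[|[|l]]] l3].
Qed.

Theorem theorem2p6 (R : realType) :
  (forall P : {mpoly R[4 + 3]}, is_simple 4 3 P ->
     exists r : nat, sos_rank 4 3 P r /\ (r <= 7)%N) /\
  (exists P : {mpoly R[4 + 3]},
     is_simple 4 3 P /\ sos_rank 4 3 P 7).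
Proof.
split=> [P [_ [E PE]] | ]; last first.
  exists (edge_form R hexagon_pendant); split; first exact: edge_form_is_simple.
  by rewrite -card_hexagon_pendant; apply/c4_free_sos_rank/hexagon_pendant_c4_free.
have [s sosP s7] := edge_form43_squares R E; rewrite {}PE.
(* The rank is the least number of squares; excluded middle finds it. *)
have ex : exists r, `[< sum_of_r_squares 4 3 (edge_form R E) r >].
  by exists s; apply/asboolP.
case: (ex_minnP ex) => r /asboolP sosr minr; exists r; split.
  by split=> // t sost; apply/minr/asboolP.
by apply: leq_trans s7; apply/minr/asboolP.
Qed.
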